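(* Let $p>3$ be a prime and $m,n\in\mathbb Z_p$ with $mn\not\equiv0\pmod p$. Then $$\sum_{x=0}^{p-1}\Big(\frac{x^3+mx+n}p\Big)\equiv\begin{cases}-(-3m)^{\frac{p-1}4}\displaystyle\sum_{k=0}^{[p/12]}\binom{[\frac p{12}]}k\binom{[\frac{5p}{12}]}k\Big(\frac{4m^3+27n^2}{4m^3}\Big)^k\pmod p&\text{if }4\mid p-1,\\[2mm] -\frac{3n}{2m^2}(-3m)^{\frac{p+1}4}\displaystyle\sum_{k=0}^{[p/12]}\binom{[\frac p{12}]}k\binom{[\frac{5p}{12}]}k\Big(\frac{4m^3+27n^2}{4m^3}\Big)^k\pmod p&\text{if }4\mid p-3,\end{cases}$$ and $$\sum_{x=0}^{p-1}\Big(\frac{x^3+mx+n}p\Big)\equiv\begin{cases}(-1)^{\frac{p+1}2}\big(\frac n2\big)^{\frac{p-1}6}\displaystyle\sum_{k=0}^{[p/12]}\binom{[\frac p6]}{2k}\binom{\frac{p-1}2}k\Big(-\frac{4m^3+27n^2}{27n^2}\Big)^k\pmod p&\text{if }3\mid p-1,\\[2mm](-1)^{\frac{p+1}2}\frac m3\big(\frac n2\big)^{\frac{p-5}6}\displaystyle\sum_{k=0}^{[p/12]}\binom{[\frac p6]}{2k}\binom{\frac{p-1}2}k\Big(-\frac{4m^3+27n^2}{27n^2}\Big)^k\pmod p&\text{if }3\mid p-2.\end{cases}$$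
   Context: $\mathbb Z_p$ is the set of rationals with denominator coprime to $p$; congruences mod $p$ are in $\mathbb Z_p$. $[x]$ is the floor of $x$. $\big(\frac ap\big)$ is the Legendre symbol (for $a\in\mathbb Z_p$ via its residue mod $p$). *)

(* Defs.v *)
From mathcomp Require Import all_boot all_order all_algebra.

Set Implicit Arguments.
Unset Strict Implicit.
Unset Printing Implicit Defensive.

Import Order.TTheory GRing.Theory Num.Theory.
Local Open Scope ring_scope.

(* The ring Z_p of rationals with denominator coprime to p (denq is the
   positive denominator in lowest terms). *)
Definition Zloc (p : nat) : pred rat := [pred a | coprime p `|denq a|].

(* a = b mod p in Z_p: both sides lie in Z_p, and so does (a - b) / p. *)
Definition Zcongr (p : nat) (a b : rat) : bool :=
  [&& a \in Zloc p, b \in Zloc p & (a - b) / p%:R \in Zloc p].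

(* For p prime and a in Z_p, ratr a is numq a / denq a computed in 'F_p, that
   is, the residue of a mod p.  Only meaningful under these conditions. *)
Definition residue (p : nat) (a : rat) : 'F_p := ratr a.

Definition legendre (p : nat) (a : rat) : int :=
  if residue p a == 0 then 0
  else if [exists y : 'F_p, y ^+ 2 == residue p a] then 1 else -1.

(* Main.v *)
Require Import Defs.
From mathcomp Require Import all_boot all_order all_algebra.
From mathcomp Require Import all_solvable all_field.
From mathcomp Require Import ring zify.

Set Implicit Arguments.
Unset Strict Implicit.
Unset Printing Implicit Defensive.

Import Order.TTheory GRing.Theory Num.Theory.
Local Open Scope ring_scope.

(* Write p = 2h + 1.  By Euler's criterion the character sum is, in F_p,
   sum_x (x^3 + m x + n)^h, i.e. minus the coefficient of X^(2h) in
   (X^3 + m X + n)^h.  That coefficient is a monomial in m and n times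
   sum_j c_j t^j, where the c_j are trinomial coefficients and t = n^2/m^3,
   or t = m^3/n^2 when the c_j are read in the reverse order.  Modulo p they
   satisfy the same first order recurrence as the coefficients of
   sum_k C(r, k) C(s, k) (1 + rho t)^k, which Vandermonde's identity computes
   (here rho = 27/4, s = [5p/12], resp. rho = 4/27, s = [7p/12], and
   r = [p/12]).  So the two polynomials in t are proportional.  The ratio is
   found at 1 + rho t = 0, realised by m = -3, n = 2: there
   x^3 - 3 x + 2 = (x - 1)^2 (x + 2) and the power sum is -3^h. *)

(** * Binomial identities *)

Lemma exprDn1_wide (F : comNzRingType) (n k : nat) (w : F) : (k <= n)%N ->
  (1 + w) ^+ k = \sum_(j < n.+1) 'C(k, j)%:R * w ^+ j.
Proof.
move=> le_kn; rewrite exprDn (big_ord_widen n.+1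
  (fun j : nat => (1 ^+ (k - j) * w ^+ j) *+ 'C(k, j))) // big_mkcond /=.
apply: eq_bigr => j _; rewrite expr1n mul1r mulr_natl ltnS.
by case: leqP => // lt_kj; rewrite bin_small.
Qed.

(** Trinomial revision, with the last lower index complemented to [s - k] so that a sum over [k]
    against ['C(r, k)] has Vandermonde's shape. For [k < j] both sides vanish. *)
Lemma bin_mul_bin (s k j : nat) : (j <= s)%N -> (k <= s)%N ->
  ('C(s, k) * 'C(k, j) = 'C(s, j) * 'C(s - j, s - k))%N.
Proof.
move=> le_js le_ks; have [lt_kj | le_jk] := ltnP k j.
  by rewrite !(@bin_small (s - j)) ?(bin_small lt_kj) ?muln0 //; lia.
have f0 : (0 < j`! * (k - j)`! * (s - k)`!)%N by rewrite !muln_gt0 !fact_gt0.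
apply/eqP; rewrite -(eqn_pmul2r f0); apply/eqP.
have:= bin_fact le_ks; have:= bin_fact le_jk; have:= bin_fact le_js.
have /bin_fact : (s - k <= s - j)%N by lia.
have -> : (s - j - (s - k) = k - j)%N by lia.
by nia.
Qed.

(** After [bin_mul_bin] the factor ['C(s, j)] leaves the sum, and the rest is Vandermonde's
    convolution of [r] and [s - j] at [s]. *)
Lemma sum_bin_bin_bin (r s j : nat) : (r <= s)%N ->
  (\sum_(k < r.+1) 'C(r, k) * 'C(s, k) * 'C(k, j) = 'C(s, j) * 'C(r + s - j, s))%N.
Proof.
move=> le_rs; case: (leqP j s) => [le_js | lt_sj]; last first.
  rewrite (bin_small lt_sj) mul0n big1 // => k _.
  by rewrite (@bin_small k) ?muln0 // (leq_ltn_trans _ lt_sj) // (leq_trans _ le_rs) ?leq_ord.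
rewrite (big_ord_widen s.+1 (fun k => 'C(r, k) * 'C(s, k) * 'C(k, j))%N) //.
rewrite big_mkcond /= -addnBA // -binomial.Vandermonde big_distrr /=; apply: eq_bigr => k _.
have [_ | lt_rk] := leqP k.+1 r.+1; last by rewrite (@bin_small r) // muln0.
by rewrite -mulnA bin_mul_bin ?leq_ord // mulnCA.
Qed.

Lemma sum_bin_shift (F : comNzRingType) (r s : nat) (w : F) : (r <= s)%N ->
  \sum_(0 <= k < r.+1) 'C(r, k)%:R * 'C(s, k)%:R * (1 + w) ^+ k =
  \sum_(0 <= j < r.+1) ('C(s, j) * 'C(r + s - j, s))%:R * w ^+ j.
Proof.
move=> le_rs; rewrite !big_mkord.
under eq_bigr => k _ do rewrite (@exprDn1_wide _ r) ?leq_ord // mulr_sumr.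
rewrite exchange_big /=; apply: eq_bigr => j _.
rewrite -sum_bin_bin_bin // natr_sum mulr_suml; apply: eq_bigr => k _.
by rewrite !natrM !mulrA.
Qed.

(** Both products are trinomial coefficients with the same total, for the exponents (a, b+3, c) and
    (a+1, b, c+2). Trading three factors [m X] for one [X^3] and two [n] keeps both the degree and
    the number of factors. *)
Lemma trinomial_step (a b c : nat) :
  ('C(a + b.+3 + c, a) * 'C(b.+3 + c, b.+3) * (b.+1 * b.+2 * b.+3) =
   'C(a.+1 + b + c.+2, a.+1) * 'C(b + c.+2, b) * (a.+1 * (c.+1 * c.+2)))%N.
Proof.
have tri x y z : ('C(x + y + z, x) * 'C(y + z, y) * (x`! * y`! * z`!) = (x + y + z)`!)%N.
  have:= @bin_fact (x + y + z) x; have:= @bin_fact (y + z) y.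
  rewrite -addnA !leq_addr !addKn => <- // <- //; nia.
have := tri a b.+3 c; have := tri a.+1 b c.+2.
have -> : (a.+1 + b + c.+2 = a + b.+3 + c)%N by lia.
move=> <- /eqP; rewrite !factS => /eqP E.
have f0 : (0 < a`! * b`! * c`!)%N by rewrite !muln_gt0 !fact_gt0.
apply/eqP; rewrite -(eqn_pmul2r f0); apply/eqP.
by lia.
Qed.

(** * Polynomials determined by a first order recurrence *)

Section Proportional.
Variables (F : fieldType) (r s : nat) (rho : F).
Hypotheses (le_rs : (r <= s)%N) (rho0 : rho != 0).
Hypothesis nat_neq0 : forall i, (0 < i <= r + s)%N -> i%:R != 0 :> F.

Lemma bin_neq0 n k : (k <= n <= r + s)%N -> 'C(n, k)%:R != 0 :> F.
Proof.
move=> /andP[le_kn le_n]; suff: n`!%:R != 0 :> F.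
  by rewrite -(bin_fact le_kn) natrM mulf_eq0 negb_or => /andP[].
elim: n le_n {le_kn} => [|n IHn] le_n; first by rewrite oner_neq0.
by rewrite factS natrM mulf_neq0 //; [apply: nat_neq0 | apply: IHn; exact: ltnW].
Qed.

(** The coefficients [d j] of the sum over [k], expanded in powers of [t], obey the same recurrence,
    whose factors [j.+1] and [r + s - j] are invertible; hence [c] is a multiple of [d]. The
    multiplier is read off at [t = - rho^-1]. *)
Lemma hypergeometric_shift (c : nat -> F) :
  (forall j, (j < r)%N ->
     c j.+1 * j.+1%:R * (r + s - j)%:R = rho * c j * (s - j)%:R * (r - j)%:R) ->
  forall t, \sum_(0 <= j < r.+1) c j * t ^+ j =
    (\sum_(0 <= j < r.+1) c j * (- rho^-1) ^+ j) *
    \sum_(0 <= k < r.+1) 'C(r, k)%:R * 'C(s, k)%:R * (1 + rho * t) ^+ k.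
Proof.
move=> c_rec; pose d j : F := ('C(s, j) * 'C(r + s - j, s))%:R * rho ^+ j.
have d_rec j : (j < r)%N ->
    d j.+1 * j.+1%:R * (r + s - j)%:R = rho * d j * (s - j)%:R * (r - j)%:R.
  move=> lt_jr; have E1 := mul_bin_left s j; have E2 := mul_bin_down (r + s - j) s.
  have [E3 E4] : ((r + s - j).-1 = r + s - j.+1 /\ r + s - j - s = r - j)%N by lia.
  rewrite E3 E4 in E2; move/(congr1 (fun n => n%:R : F)): E1; move/(congr1 (fun n => n%:R : F)): E2.
  rewrite /d exprS !natrM => E2 E1.
  rewrite [LHS](_ : _ = rho * rho ^+ j * (j.+1%:R * 'C(s, j.+1)%:R) *
    ((r + s - j)%:R * 'C(r + s - j.+1, s)%:R)); last by ring.
  by rewrite E1 E2; ring.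
have cd j : (j <= r)%N -> c j * d 0%N = c 0%N * d j.
  elim: j => [|j IHj] lt_jr; first by [].
  have n0 : j.+1%:R * (r + s - j)%:R != 0 :> F by rewrite mulf_neq0 ?nat_neq0 //; lia.
  apply: (mulIf n0); have:= c_rec _ lt_jr; have:= d_rec _ lt_jr; have:= IHj (ltnW lt_jr).
  move=> E1 E2 E3.
  transitivity (rho * (s - j)%:R * (r - j)%:R * (c j * d 0%N)).
    by transitivity (c j.+1 * j.+1%:R * (r + s - j)%:R * d 0%N); [ring | rewrite E3; ring].
  rewrite E1; transitivity (d j.+1 * j.+1%:R * (r + s - j)%:R * c 0%N); last by ring.
  by rewrite E2; ring.
have d0 : d 0%N != 0 by rewrite /d mulr1 bin0 mul1n subn0 bin_neq0 // leq_addl /=.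
have sumc t : \sum_(0 <= j < r.+1) c j * t ^+ j = c 0%N / d 0%N *
    \sum_(0 <= k < r.+1) 'C(r, k)%:R * 'C(s, k)%:R * (1 + rho * t) ^+ k.
  rewrite sum_bin_shift // mulr_sumr; apply: eq_big_nat => j /andP[_ le_jr].
  rewrite exprMn; transitivity (c 0%N * d j / d 0%N * t ^+ j); first by rewrite -cd // mulfK.
  by rewrite /d; ring.
move=> t; rewrite !sumc; congr (_ * _).
(* At [t = - rho^-1] the base [1 + rho * t] is 0, so only the term [k = 0], equal to 1, survives. *)
rewrite big_ltn // big_nat_cond big1 => [|k /andP[/andP[k0 _] _]].
  by rewrite !bin0 expr0 addr0 !mulr1.
by rewrite mulrN mulfV // subrr expr0n gtn_eqF // mulr0.
Qed.
End Proportional.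

(** * Finite fields *)

Section FiniteField.
Variable F : finFieldType.

Lemma finField_expf1 (x : F) : x != 0 -> x ^+ #|F|.-1 = 1.
Proof.
move=> x0; apply: (mulfI x0).
by rewrite -exprS prednK ?expf_card ?mulr1 // (cardD1 0).
Qed.

Lemma finField_prim_root : {z : F | #|F|.-1.-primitive_root z}.
Proof.
pose rs := [seq x <- enum F | x != 0].
have/hasP/sig2W[z _ z_prim] : has #|F|.-1.-primitive_root rs; last by exists z.
apply: has_prim_root.
- by rewrite -ltnS prednK ?finNzRing_gt1 // (cardD1 0).
- apply/allP=> x; rewrite mem_filter => /andP[x0 _].
  by apply/unity_rootP; rewrite finField_expf1.
- by rewrite filter_uniq ?enum_uniq.
by rewrite -(cardC1 (0 : F)) size_filter -sum1_card -sum1_count big_enum_cond.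
Qed.

(** Multiplication by a primitive root [z] permutes F and scales the power sum by [z ^+ k], so the
    sum vanishes unless [z ^+ k = 1]. Below the bound this leaves only k = 0, where 0^0 = 1 makes
    the sum vanish too, and k = #|F| - 1. *)
Lemma finField_sum_expr (k : nat) : (k < #|F|.-1.*2)%N ->
  \sum_(x : F) x ^+ k = - (k == #|F|.-1)%:R.
Proof.
have [z z_prim] := finField_prim_root; have q0 := prim_order_gt0 z_prim.
have z0 : z != 0.
  have /eqP := prim_expr_order z_prim; apply: contraTneq => ->.
  by rewrite expr0n gtn_eqF // eq_sym oner_eq0.
(* The translation by 1 permutes F, so the sum of all [x] equals itself plus this sum. *)
have sum1 : \sum_(x : F) 1 = 0 :> F.
  have : \sum_(x : F) x = \sum_(x : F) (x + 1).
    by rewrite [LHS](reindex_inj (addIr 1)).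
  by rewrite big_split /= => /esym/eqP; rewrite addrC -subr_eq0 addrK => /eqP.
have sum_small j : (j < #|F|.-1)%N -> \sum_(x : F) x ^+ j = 0.
  case: j => [_|j lt_j]; first by rewrite -[RHS]sum1; apply: eq_bigr => x _; rewrite expr0.
  have E : \sum_(x : F) x ^+ j.+1 = z ^+ j.+1 * \sum_(x : F) x ^+ j.+1.
    by rewrite [LHS](reindex_inj (mulfI z0)) mulr_sumr; apply: eq_bigr => x _; rewrite exprMn.
  have : (1 - z ^+ j.+1) * \sum_(x : F) x ^+ j.+1 = 0 by rewrite mulrBl mul1r -E subrr.
  move/eqP; rewrite mulf_eq0 subr_eq0 eq_sym -(prim_order_dvd z_prim) gtnNdvd //.
  by move/eqP.
rewrite -addnn => lt_k; case: ltngtP => [lt_kq | lt_qk | ->].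
- by rewrite sum_small // oppr0.
(* The exponent drops by #|F| - 1 and stays positive, so the term at 0 is unaffected. *)
- rewrite oppr0 -[RHS](@sum_small (k - #|F|.-1)%N); last by lia.
  apply: eq_bigr => x _; rewrite -{1}(subnK (ltnW lt_qk)) exprD.
  have [->|x0] := eqVneq x 0; last by rewrite finField_expf1 // mulr1.
  by rewrite expr0n gtn_eqF ?subn_gt0 // mul0r.
rewrite (bigD1 0) //= expr0n gtn_eqF // add0r.
rewrite (eq_bigr (fun=> 1)) => [|x x0]; last by rewrite finField_expf1.
by move: sum1; rewrite (bigD1 0) //= => /eqP; rewrite addrC addr_eq0 => /eqP.
Qed.

Lemma finField_sum_horner (f : {poly F}) : (size f <= #|F|.-1.*2)%N ->
  \sum_(x : F) f.[x] = - f`_(#|F|.-1).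
Proof.
have [z z_prim] := finField_prim_root; have q0 := prim_order_gt0 z_prim.
move=> le_f; under eq_bigr => x _ do rewrite (horner_coef_wide x le_f).
have lt_q : (#|F|.-1 < #|F|.-1.*2)%N by rewrite -addnn -{1}[#|F|.-1]addn0 ltn_add2l.
rewrite exchange_big /= (bigD1 (Ordinal lt_q)) //= -mulr_sumr finField_sum_expr // eqxx mulrN1.
rewrite big1 ?addr0 // => i ne_i.
rewrite -mulr_sumr finField_sum_expr //.
by rewrite -val_eqE /= in ne_i; rewrite (negPf ne_i) oppr0 mulr0.
Qed.

Variable h : nat.
Hypothesis cardF : #|F| = h.*2.+1.

(** A nonsquare is an odd power [z ^+ i] of a primitive root. Its power [a ^+ h] squares to 1, and
    cannot be 1 because 2h would divide i h. *)
Lemma finField_euler (a : F) : a != 0 ->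
  a ^+ h = if [exists y : F, y ^+ 2 == a] then 1 else -1.
Proof.
move=> a0; case: existsP => [[y /eqP Dy] | nsq].
  have y0 : y != 0 by apply: contraNneq a0 => y0; rewrite -Dy y0 expr0n.
  by rewrite -Dy -exprM mul2n; have := finField_expf1 y0; rewrite cardF.
have [z z_prim] := finField_prim_root; have z1 := prim_expr_order z_prim.
have := finField_expf1 a0 => /(prim_rootP z_prim)[[i /= _] Di].
have odd_i : odd i.
  apply: contra_notT nsq => ev_i; exists (z ^+ i./2).
  by rewrite -exprM muln2 even_halfK // -Di.
have : (a ^+ h) ^+ 2 = 1 by rewrite -exprM muln2; have := finField_expf1 a0; rewrite cardF.
move/eqP; rewrite sqrf_eq1 => /orP[|/eqP //].
rewrite Di -exprM -(prim_order_dvd z_prim) cardF /= -mul2n dvdn_pmul2r ?dvdn2 ?odd_i //.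
by have := prim_order_gt0 z_prim; rewrite cardF /= double_gt0.
Qed.

(** Here F contains a primitive cube root of unity [w], and -3 = (2w + 1)^2 is a square. *)
Lemma finField_minus3_split (u : nat) : (3%:R : F) != 0 -> #|F| = (3 * u).+1 ->
  (- 3%:R : F) ^+ h = 1.
Proof.
move=> n3 cardF3; have [z z_prim] := finField_prim_root.
have z1 := prim_expr_order z_prim; pose w := z ^+ u.
have w1 : w - 1 != 0.
  have := prim_order_gt0 z_prim; rewrite subr_eq0 -(prim_order_dvd z_prim) cardF3 /= => ?.
  by rewrite gtnNdvd //; lia.
have w3 : w ^+ 2 + w + 1 = 0.
  have w31 : w ^+ 3 = 1 by rewrite -exprM mulnC -z1 cardF3.
  have E : (w - 1) * (w ^+ 2 + w + 1) = w ^+ 3 - 1 by ring.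
  by apply: (mulfI w1); rewrite E w31 subrr mulr0.
have Dm3 : - 3%:R = (2%:R * w + 1) ^+ 2 :> F 
    by rewrite [RHS](_ : _ = 4%:R * (w ^+ 2 + w + 1) - 3%:R); [rewrite w3 mulr0 add0r | ring].
have m30 : - 3%:R != 0 :> F by rewrite oppr_eq0.
rewrite finField_euler //; case: existsP => // [[]]; exists (2%:R * w + 1).
by rewrite Dm3.
Qed.

(** A square root [y] of -3 would make w = (y - 1)/2 a root of w^2 + w + 1, hence w^3 = 1. As #|F| -
    1 is 1 modulo 3, this forces w = 1 and then 3 = 0. *)
Lemma finField_minus3_inert (u : nat) : (2%:R : F) != 0 -> (3%:R : F) != 0 ->
  #|F| = (3 * u).+2 -> (- 3%:R : F) ^+ h = -1.
Proof.
move=> n2 n3 cardF3.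
have m30 : - 3%:R != 0 :> F by rewrite oppr_eq0.
rewrite finField_euler //; case: existsP => // -[y /eqP Dy].
pose w := (y - 1) / 2%:R.
have w3 : w ^+ 2 + w + 1 = 0.
  have -> : w ^+ 2 + w + 1 = (y ^+ 2 + 3%:R) / 4%:R.
    by rewrite /w; field; rewrite (natrM F 2 2) mulf_neq0 n2.
  by rewrite Dy addNr mul0r.
have w31 : w ^+ 3 = 1.
  apply/eqP; rewrite -subr_eq0 (_ : _ - 1 = (w - 1) * (w ^+ 2 + w + 1)); last by ring.
  by rewrite w3 mulr0.
have w0 : w != 0 by apply: contra_eqN w31 => /eqP ->; rewrite expr0n eq_sym oner_eq0.
have := finField_expf1 w0; rewrite cardF3 /= exprSr exprM w31 expr1n mul1r.
move => w1.
move: n3; rewrite (_ : 3%:R = w ^+ 2 + w + 1); last by rewrite w1; ring.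
by rewrite w3 eqxx.
Qed.
End FiniteField.

(** * The middle coefficient of powers of a cubic *)

Lemma big_nat_support (R : nmodType) (f : nat -> R) (A r n : nat) : (A + r < n)%N ->
  (forall a, (a < n)%N -> ~~ (A <= a <= A + r)%N -> f a = 0) ->
  \sum_(0 <= a < n) f a = \sum_(0 <= j < r.+1) f (A + j)%N.
Proof.
move=> lt_n f0; rewrite (@big_cat_nat _ _ _ A) //=; last by lia.
rewrite (@big_cat_nat _ _ _ (A + r).+1 A n) //=; last by lia.
rewrite big_nat_cond big1 ?add0r => [|a /andP[/andP[_ lt_aA] _]]; last by apply: f0; lia.
rewrite [X in _ + X]big_nat_cond [X in _ + X]big1 ?addr0; last first.
  by move=> a /andP[/andP[lt_Aa lt_an] _]; apply: f0; lia.
rewrite -{1}[A]add0n big_addn -addnS addKn.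
by apply: eq_bigr => j _; rewrite addnC.
Qed.

Lemma coef_linear_exp (R : comNzRingType) (m n : R) (N b : nat) :
  ((n%:P + m *: 'X) ^+ N)`_b = 'C(N, b)%:R * m ^+ b * n ^+ (N - b).
Proof.
rewrite exprDn coef_sum.
under eq_bigr => i _ do
  rewrite coefMn exprZn -polyC_exp mulrC -mul_polyC -mulrA coefCM coefMC coefXn.
have [le_bN | lt_Nb] := leqP b N; last first.
  rewrite bin_small // !mul0r big1 // => i _.
  by rewrite gtn_eqF ?mul0r ?mulr0 ?mul0rn // (leq_trans (ltn_ord i)).
have lt_b : (b < N.+1)%N by [].
rewrite (bigD1 (Ordinal lt_b)) //= eqxx mul1r big1 ?addr0 => [|i].
  by rewrite mulr_natl mulrnAl.
by rewrite -val_eqE /= eq_sym => /negPf->; rewrite mul0r mulr0 mul0rn.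
Qed.

(** For p = 2h + 1 the index is p - 1, the exponent detected by summation over the field. *)
Definition cubic_coef (R : comNzRingType) (h : nat) (m n : R) : R :=
  (('X^3 + m *: 'X + n%:P) ^+ h)`_(h.*2).

(** The trinomial coefficient h! / (a! b! c!) with b = 2h - 3a and c = 2a - h, where a, b, c count
    the factors [X^3], [m X], [n] of a term of degree 2h. It is 0 when 2a < h. *)
Definition trin (h a : nat) : nat := 'C(h, a) * 'C(h - a, h.*2 - 3 * a).

(** The guard excludes the indices where the truncated [h.*2 - 3 * a] would pick up a constant
    coefficient. For 2a < h the truncated exponent of [n] is harmless, since [trin h a] vanishes. *)
Lemma cubic_coefE (R : comNzRingType) (h : nat) (m n : R) :
  cubic_coef h m n = \sum_(0 <= a < h.+1)
    (if (3 * a <= h.*2)%N then (trin h a)%:R * m ^+ (h.*2 - 3 * a) * n ^+ (a.*2 - h) else 0).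
Proof.
rewrite /cubic_coef -addrA addrC [_ *: _ + _]addrC exprDn coef_sum big_mkord.
apply: eq_bigr => a _; rewrite coefMn -exprM coefMXn ltnNge.
case: leqP => [le_a | _]; last by rewrite mul0rn.
rewrite /= coef_linear_exp -[LHS]mulr_natl !mulrA /trin natrM.
have [le_ha | lt_ah] := leqP h a.*2; last by rewrite (@bin_small (h - a)) ?mulr0 ?mul0r //; lia.
by congr (_ * _ ^+ _); have := ltn_ord a; lia.
Qed.

(** * The coefficient over the field with p elements *)

Section CubicCoef.
Variables (F : finFieldType) (p h : nat).
Hypotheses (charF : p \in [pchar F]) (cardF : #|F| = p) (p_gt3 : (3 < p)%N) (Dp : p = h.*2.+1).

Lemma pchar_natr_neq0 i : (0 < i < p)%N -> i%:R != 0 :> F.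
Proof. by move=> /andP[i0 lt_ip]; rewrite -(dvdn_pcharf charF) gtnNdvd. Qed.

Lemma natr_half : 2%:R * h%:R = -1 :> F.
Proof.
apply/eqP; rewrite eq_sym -subr_eq0 -opprD oppr_eq0 -natrM addrC -(natrD F _ 1).
by rewrite addn1 mul2n -Dp (pcharf0 charF).
Qed.

(** The degree is at most 3h, below 2(p - 1) = 4h, so [finField_sum_horner] applies. *)
Lemma sum_cubic_exp (m n : F) : \sum_(x : F) (x ^+ 3 + m * x + n) ^+ h = - cubic_coef h m n.
Proof.
pose f : {poly F} := ('X^3 + m *: 'X + n%:P) ^+ h.
have sz : (size ('X^3 + m *: 'X + n%:P)%R <= 4)%N.
  rewrite -addrA (leq_trans (size_polyD _ _)) // geq_max size_polyXn /=.
  rewrite (leq_trans (size_polyD _ _)) // geq_max (leq_trans (size_scale_leq _ _)) ?size_polyX //=.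
  by rewrite (leq_trans (size_polyC_leq1 _)).
have szf : (size f <= (3 * h).+1)%N.
  by apply: leq_trans (size_poly_exp_leq _ _) _; rewrite ltnS leq_mul //; lia.
transitivity (\sum_(x : F) f.[x]).
  by apply: eq_bigr => x _; rewrite /f !hornerE.
rewrite finField_sum_horner cardF Dp //=.
by apply: leq_trans szf _; lia.
Qed.

(* [x^3 - 3x + 2 = (x - 1)^2 (x + 2)], where the discriminant vanishes. *)
Lemma cubic_coef_singular : cubic_coef h (- 3%:R) 2%:R = 3%:R ^+ h :> F.
Proof.
apply: oppr_inj; rewrite -sum_cubic_exp.
(* A translate of the power sum with exponent h < p - 1. *)
have E : \sum_(x : F) (x + 2%:R) ^+ h = 0.
  have := finField_sum_expr (F := F) (k := h); rewrite (reindex_inj (addIr 2%:R)) /= => ->.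
    by rewrite ltn_eqF ?oppr0 // cardF Dp /=; lia.
  by rewrite cardF Dp /=; lia.
rewrite (bigD1 1) //= in E; rewrite (bigD1 1) //=.
rewrite [X in X ^+ h](_ : _ = 0); last by ring.
rewrite expr0n gtn_eqF ?add0r; last by lia.
(* For x other than 1 the factor (x - 1)^(2h) is 1. What remains is the sum [E] without its term 3^h
   at x = 1. *)
rewrite (eq_bigr (fun x => (x + 2%:R) ^+ h)) => [|x x1].
  by move/eqP: E; rewrite addrC addr_eq0 => /eqP->; congr (- _ ^+ h); ring.
rewrite (_ : _ + _ = (x - 1) ^+ 2 * (x + 2%:R)); last by ring.
have x10 : x - 1 != 0 by rewrite subr_eq0.
by have := finField_expf1 x10; rewrite exprMn -exprM mul2n cardF Dp /= => ->; rewrite mul1r.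
Qed.

(** This is [trinomial_step] modulo p, divided by a + 1 and multiplied by 4: since 2h = -1, the
    exponents become b = -4 - 3a and 2c = 4a + 1. *)
Lemma trin_step a : (h <= a.*2)%N -> (3 * a.+1 <= h.*2)%N ->
  (4%:R * a%:R + 3%:R) * (4%:R * a%:R + 5%:R) * (trin h a.+1)%:R =
  - 12%:R * (3%:R * a%:R + 1) * (3%:R * a%:R + 2%:R) * (trin h a)%:R :> F.
Proof.
move=> le_ha le_ah; pose b := (h.*2 - 3 * a.+1)%N; pose c := (a.*2 - h)%N.
have := trinomial_step a b c; rewrite /trin.
have [-> -> -> ->] : [/\ (a + b.+3 + c = h)%N, (b.+3 + c = h - a)%N,
  (a.+1 + b + c.+2 = h)%N & (b + c.+2 = h - a.+1)%N] by rewrite /b /c; split; lia.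
have -> : (h.*2 - 3 * a = b.+3)%N by rewrite /b; lia.
have h2 := natr_half.
have Db : b%:R = - 4%:R - 3%:R * a%:R :> F.
  have : (b + 3 * a + 3)%N%:R = (2 * h)%N%:R :> F by congr _%:R; rewrite /b; lia.
  rewrite [LHS]natrD (natrD _ b) !natrM h2 => E.
  by rewrite -[LHS](addrK (3%:R * a%:R + 3%:R)) addrA E; ring.
have Dc : 2%:R * c%:R = 4%:R * a%:R + 1 :> F.
  have : (2 * c + 2 * h)%:R = (4 * a)%:R :> F by congr _%:R; rewrite /c; lia.
  by rewrite natrD !natrM h2 => <-; rewrite subrK.
move/(congr1 (fun i => i%:R : F)).
set X := ('C(h, a) * _)%N; set Y := ('C(h, a.+1) * _)%N.
rewrite [(X * _)%:R]natrM [(Y * _)%:R]natrM.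
have -> : (b.+1 * b.+2 * b.+3)%:R = (b%:R + 1) * (b%:R + 2%:R) * (b%:R + 3%:R) :> F.
  by rewrite !natrM -(addn3 b) -(addn2 b) -(addn1 b) !natrD.
have -> : (a.+1 * (c.+1 * c.+2))%:R = (a%:R + 1) * ((c%:R + 1) * (c%:R + 2%:R)) :> F.
  by rewrite !natrM -(addn2 c) -(addn1 c) -(addn1 a) !natrD.
rewrite Db => E.
have a1 : a.+1%:R != 0 :> F by apply: pchar_natr_neq0; lia.
apply: (mulfI a1); rewrite -natr1.
transitivity (4%:R * (Y%:R * ((a%:R + 1) * ((c%:R + 1) * (c%:R + 2%:R)))) : F).
  transitivity ((a%:R + 1) * Y%:R * (2%:R * c%:R + 2%:R) * (2%:R * c%:R + 4%:R) : F); last by ring.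
  by rewrite Dc; ring.
by rewrite -E; ring.
Qed.

Let n2 : 2%:R != 0 :> F. Proof. by apply: pchar_natr_neq0; lia. Qed.
Let n3 : 3%:R != 0 :> F. Proof. by apply: pchar_natr_neq0; lia. Qed.

(** The nonzero terms have indices from [A], the least a with 2a >= h, to [A + r], the largest with
    3a <= 2h. The two identities in [J] turn [trin_step] into the recurrence of
    [hypergeometric_shift] with rho = 27/4. The point (-3, 2) has t = -4/27 = -1/rho, so
    [cubic_coef_singular] gives the multiplier; its monomial is kept on the left to avoid a
    division. *)
Lemma cubic_coef_up (A r s : nat) (m n : F) :
  (r <= s)%N -> (r + s < p)%N -> (h <= A.*2 <= h.+1)%N ->
  (3 * (A + r) <= h.*2 < 3 * (A + r).+1)%N ->
  (forall J : F, 16%:R * ((J + 1) * (r%:R + s%:R - J)) =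
     - ((4%:R * (A%:R + J) + 3%:R) * (4%:R * (A%:R + J) + 5%:R))) ->
  (forall J : F, 9%:R * ((s%:R - J) * (r%:R - J)) =
     (3%:R * (A%:R + J) + 1) * (3%:R * (A%:R + J) + 2%:R)) ->
  m != 0 ->
  cubic_coef h m n * ((- 3%:R) ^+ (h.*2 - 3 * A) * 2%:R ^+ (A.*2 - h)) =
  3%:R ^+ h * (m ^+ (h.*2 - 3 * A) * n ^+ (A.*2 - h)) *
  \sum_(0 <= k < r.+1) 'C(r, k)%:R * 'C(s, k)%:R *
     (1 + 27%:R / 4%:R * (n ^+ 2 / m ^+ 3)) ^+ k.
Proof.
move=> le_rs lt_rs /andP[A_ge A_le] /andP[Ar_le Ar_gt] rec1 rec2 m0.
have bnd j : (j < r)%N ->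
    [/\ (h <= (A + j).*2)%N, (3 * (A + j).+1 <= h.*2)%N, (j <= s)%N & (j <= r + s)%N].
  by move=> lt_jr; split; lia.
pose c j : F := (trin h (A + j))%:R; pose b := (h.*2 - 3 * A)%N; pose e := (A.*2 - h)%N.
have expand (x y : F) : x != 0 -> cubic_coef h x y =
    x ^+ b * y ^+ e * \sum_(0 <= j < r.+1) c j * (y ^+ 2 / x ^+ 3) ^+ j.
  move=> x0; rewrite cubic_coefE (big_nat_support (A := A) (r := r)); first last.
  - move=> a lt_ah nAa; case: ifP => // le_a; rewrite /trin (@bin_small (h - a)); last by lia.
    by rewrite muln0 !mul0r.
  - by lia.
  rewrite mulr_sumr; apply: eq_big_nat => j /andP[_ lt_j]; rewrite ifT; last by lia.
  have -> : ((A + j).*2 - h = e + 2 * j)%N by rewrite /e; lia.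
  have -> : b = (h.*2 - 3 * (A + j) + 3 * j)%N by rewrite /b; lia.
  rewrite (exprD x) (exprD y) (exprM x) (exprM y) expr_div_n -/(c j).
  have : x ^+ 3 ^+ j != 0 by rewrite !expf_neq0.
  by move=> ?; field.
have n4 : 4%:R != 0 :> F by rewrite (natrM F 2 2) mulf_neq0.
have n27 : 27%:R != 0 :> F by rewrite (natrM F 3 9) (natrM F 3 3) !mulf_neq0.
have n16 : 16%:R != 0 :> F by rewrite (natrM F 4 4) mulf_neq0.
have shift := @hypergeometric_shift F r s (27%:R / 4%:R) le_rs _ _ c.
rewrite -/b -/e expand // shift; first last.
- move=> j lt_jr; rewrite /c addnS; have [b1 b2 b3 b4] := bnd j lt_jr.
  have := trin_step b1 b2; rewrite natrD => E.
  rewrite (natrB _ b3) (natrB _ b4) (natrB _ (ltnW lt_jr)) natrD.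
  apply: (mulfI n16); rewrite -(@natr1 F j).
  transitivity ((trin h (A + j).+1)%:R * (16%:R * ((j%:R + 1) * (r%:R + s%:R - j%:R))) : F).
    by ring.
  rewrite rec1 mulrN mulrC E.
  transitivity (12%:R * (9%:R * ((s%:R - j%:R) * (r%:R - j%:R))) * (trin h (A + j))%:R : F).
    by rewrite rec2; ring.
  by field.
- by move=> i /andP[i0 le_i]; rewrite pchar_natr_neq0 // i0 (leq_ltn_trans le_i).
- by rewrite mulf_neq0 ?invr_neq0.
have := cubic_coef_singular; rewrite expand ?oppr_eq0 //.
rewrite (_ : 2%:R ^+ 2 / _ = - (27%:R / 4%:R)^-1); last first.
  by field; rewrite oppr_eq0 n4 n27.
move=> <-; ring.
Qed.

(** The same window of indices is read from its top [A] downwards. The variable becomes m^3/n^2, rho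
    becomes 4/27, and the point (-3, 2) again gives -1/rho. *)
Lemma cubic_coef_down (A r s : nat) (m n : F) :
  (r <= s)%N -> (r + s < p)%N -> (h.*2 < 3 * A.+1)%N -> (3 * A <= h.*2)%N ->
  (h + r.*2 <= A.*2 < h + r.+1.*2)%N ->
  (forall J : F, 9%:R * ((J + 1) * (r%:R + s%:R - J)) =
     - ((3%:R * (A%:R - J) - 2%:R) * (3%:R * (A%:R - J) - 1))) ->
  (forall J : F, 16%:R * ((s%:R - J) * (r%:R - J)) =
     (4%:R * (A%:R - J) - 1) * (4%:R * (A%:R - J) + 1)) ->
  n != 0 ->
  cubic_coef h m n * ((- 3%:R) ^+ (h.*2 - 3 * A) * 2%:R ^+ (A.*2 - h)) =
  3%:R ^+ h * (m ^+ (h.*2 - 3 * A) * n ^+ (A.*2 - h)) *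
  \sum_(0 <= k < r.+1) 'C(r, k)%:R * 'C(s, k)%:R *
     (1 + 4%:R / 27%:R * (m ^+ 3 / n ^+ 2)) ^+ k.
Proof.
move=> le_rs lt_rs A_gt A_le /andP[Ar_ge Ar_lt] rec1 rec2 n0.
have bnd j : (j < r)%N ->
    [/\ (h <= (A - j.+1).*2)%N, (3 * (A - j.+1).+1 <= h.*2)%N,
        (j < A)%N, (j <= s)%N & (j <= r + s)%N].
  by move=> lt_jr; split; lia.
pose c j : F := (trin h (A - j))%:R; pose b := (h.*2 - 3 * A)%N; pose e := (A.*2 - h)%N.
have expand (x y : F) : y != 0 -> cubic_coef h x y =
    x ^+ b * y ^+ e * \sum_(0 <= j < r.+1) c j * (x ^+ 3 / y ^+ 2) ^+ j.
  move=> y0; rewrite cubic_coefE (big_nat_support (A := A - r) (r := r)); first last.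
  - move=> a lt_ah nAa; case: ifP => // le_a; rewrite /trin (@bin_small (h - a)); last by lia.
    by rewrite muln0 !mul0r.
  - by lia.
  rewrite big_nat_rev mulr_sumr; apply: eq_big_nat => j /andP[_ lt_j].
  have -> : (A - r + (0 + r.+1 - j.+1) = A - j)%N by lia.
  rewrite ifT; last by lia.
  have -> : (h.*2 - 3 * (A - j) = b + 3 * j)%N by rewrite /b; lia.
  have -> : e = ((A - j).*2 - h + 2 * j)%N by rewrite /e; lia.
  rewrite (exprD x) (exprD y) (exprM x) (exprM y) expr_div_n -/(c j).
  have : y ^+ 2 ^+ j != 0 by rewrite !expf_neq0.
  by move=> ?; field.
have n4 : 4%:R != 0 :> F by rewrite (natrM F 2 2) mulf_neq0.
have n27 : 27%:R != 0 :> F by rewrite (natrM F 3 9) (natrM F 3 3) !mulf_neq0.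
have n108 : 108%:R != 0 :> F by rewrite (natrM F 4 27) mulf_neq0.
have shift := @hypergeometric_shift F r s (4%:R / 27%:R) le_rs _ _ c.
rewrite -/b -/e expand // shift; first last.
- move=> j lt_jr; rewrite /c; have [b1 b2 b3 b4 b5] := bnd j lt_jr.
  have DA : (A - j.+1)%:R = A%:R - j%:R - 1 :> F by rewrite (natrB _ b3) -addn1 natrD opprD addrA.
  have := trin_step b1 b2; rewrite -subSn // subSS DA => E.
  rewrite (natrB _ b4) (natrB _ b5) (natrB _ (ltnW lt_jr)) natrD.
  apply: (mulfI n108); rewrite -(@natr1 F j).
  transitivity (12%:R * (trin h (A - j.+1))%:R * (9%:R * ((j%:R + 1) * (r%:R + s%:R - j%:R))) : F).
    by ring.
  rewrite rec1.
  transitivity ((16%:R * ((s%:R - j%:R) * (r%:R - j%:R))) * (trin h (A - j))%:R : F).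
    rewrite rec2; transitivity ((4%:R * (A%:R - j%:R - 1) + 3%:R) *
      (4%:R * (A%:R - j%:R - 1) + 5%:R) * (trin h (A - j))%:R : F); last by ring.
    by rewrite E; ring.
  by field.
- by move=> i /andP[i0 le_i]; rewrite pchar_natr_neq0 // i0 (leq_ltn_trans le_i).
- by rewrite mulf_neq0 ?invr_neq0.
have := cubic_coef_singular; rewrite expand //.
rewrite (_ : _ / 2%:R ^+ 2 = - (4%:R / 27%:R)^-1); last by field; rewrite ?oppr_eq0 ?n2 ?n4 ?n27.
move=> <-; ring.
Qed.

(** Induction on [k] through term ratios: since 2h = -1, the factor h - k = -(2k + 1)/2 cancels the
    odd factor 2k + 1 from ['C(u, 2 * k)] and supplies the sign. This brings the second pair of
    binomials to the form produced by [cubic_coef_down]. *)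
Lemma bin_double_mul (u r s k : nat) : (k <= r)%N -> (r <= s)%N -> (r.*2 <= u < h)%N ->
  (forall J : F, (u%:R - 2%:R * J) * (u%:R - 2%:R * J - 1) = 4%:R * ((r%:R - J) * (s%:R - J))) ->
  'C(u, 2 * k)%:R * 'C(h, k)%:R * (- 1) ^+ k = 'C(r, k)%:R * 'C(s, k)%:R :> F.
Proof.
move=> le_kr le_rs /andP[le_ru lt_uh] rel.
elim: k le_kr => [|k IHk] lt_kr; first by rewrite muln0 !bin0 !mulr1.
have natE n i : (i <= n)%N -> i.+1%:R * 'C(n, i.+1)%:R = (n%:R - i%:R) * 'C(n, i)%:R :> F.
  by move=> le_in; rewrite -natrM mul_bin_left natrM natrB.
have E1 := natE _ _ (ltnW lt_kr); have E2 := natE s k ltac:(lia).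
have E3 := natE h k ltac:(lia).
have E4 := natE u (2 * k)%N ltac:(lia); have E5 := natE u (2 * k).+1 ltac:(lia).
have Dk : (2 * k.+1 = (2 * k).+2)%N by lia.
have Dk1 : (2 * k).+1%:R = 2%:R * k%:R + 1 :> F by rewrite -natr1 natrM.
have h2 := natr_half; have IH := IHk (ltnW lt_kr).
have k0 i : (0 < i < p)%N -> i%:R != 0 :> F by exact: pchar_natr_neq0.
have nz : 2%:R * ((2 * k).+1%:R * (2 * k).+2%:R * k.+1%:R) != 0 :> F.
  by rewrite !mulf_neq0 ?k0 //; lia.
apply: (mulfI nz); rewrite Dk exprS.
have Dk2 : (2 * k).+2%:R = 2%:R * k.+1%:R :> F by rewrite -natrM mulnS.
transitivity (- ((2%:R * (k.+1%:R * 'C(h, k.+1)%:R)) * ((2 * k).+1%:R *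
   ((2 * k).+2%:R * 'C(u, (2 * k).+2)%:R)) * (-1) ^+ k) : F); first by ring.
rewrite E3 E5 [(2 * k).+1%:R * (_ * _)]mulrCA E4 natrM Dk1.
transitivity (- ((2%:R * h%:R - 2%:R * k%:R) * ((u%:R - 2%:R * k%:R) * (u%:R - 2%:R * k%:R - 1)) *
  ('C(u, 2 * k)%:R * 'C(h, k)%:R * (-1) ^+ k)) : F); first by ring.
rewrite h2 rel IH Dk2.
transitivity (4%:R * (2%:R * k%:R + 1) * ((r%:R - k%:R) * 'C(r, k)%:R) *
  ((s%:R - k%:R) * 'C(s, k)%:R) : F); first by ring.
by rewrite -E1 -E2; ring.
Qed.

End CubicCoef.

(** In each class of p modulo 12 prime to 6, [s] and [A] are affine in [r]. As [r] is a constant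
    modulo p, so are they, which makes the recurrence identities checkable class by class. *)
Lemma residue12_up (p h A : nat) : (3 < p)%N -> p = h.*2.+1 -> (0 < p %% 3)%N ->
  (h <= A.*2 <= h.+1)%N -> let r := (p %/ 12)%N in let s := (5 * p %/ 12)%N in
  [/\ r <= s, r + s < p & 3 * (A + r) <= h.*2 < 3 * (A + r).+1]%N /\
  [\/ [/\ p = 12 * r + 1, s = 5 * r + 0 & A = 3 * r + 0],
      [/\ p = 12 * r + 5, s = 5 * r + 2 & A = 3 * r + 1],
      [/\ p = 12 * r + 7, s = 5 * r + 2 & A = 3 * r + 2] |
      [/\ p = 12 * r + 11, s = 5 * r + 4 & A = 3 * r + 3]]%N.
Proof.
move=> p_gt3 Dp p_mod3 A_bnd r s; rewrite /r /s {r s}; split; first by split; lia.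
have : (p %% 12 = 1 \/ p %% 12 = 5 \/ p %% 12 = 7 \/ p %% 12 = 11)%N by lia.
by case=> [?|[?|[?|?]]]; [apply: Or41|apply: Or42|apply: Or43|apply: Or44]; split; lia.
Qed.

Lemma residue12_down (p h A : nat) : (3 < p)%N -> p = h.*2.+1 -> (0 < p %% 3)%N ->
  (h.*2 < 3 * A.+1)%N -> (3 * A <= h.*2)%N -> let r := (p %/ 12)%N in let s := (7 * p %/ 12)%N in
  let u := (p %/ 6)%N in
  [/\ r <= s, r + s < p, r.*2 <= u < h & h + r.*2 <= A.*2 < h + r.+1.*2]%N /\
  [\/ [/\ p = 12 * r + 1, s = 7 * r + 0, A = 4 * r + 0 & u = 2 * r + 0],
      [/\ p = 12 * r + 5, s = 7 * r + 2, A = 4 * r + 1 & u = 2 * r + 0],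
      [/\ p = 12 * r + 7, s = 7 * r + 4, A = 4 * r + 2 & u = 2 * r + 1] |
      [/\ p = 12 * r + 11, s = 7 * r + 6, A = 4 * r + 3 & u = 2 * r + 1]]%N.
Proof.
move=> p_gt3 Dp p_mod3 A_gt A_le r s u; rewrite /r /s /u {r s u}; split; first by split; lia.
have : (p %% 12 = 1 \/ p %% 12 = 5 \/ p %% 12 = 7 \/ p %% 12 = 11)%N by lia.
by case=> [?|[?|[?|?]]]; [apply: Or41|apply: Or42|apply: Or43|apply: Or44]; split; lia.
Qed.

(** * The four evaluations over the field with p elements *)

Section CubicSum.
Variables (F : finFieldType) (p h : nat).
Hypotheses (charF : p \in [pchar F]) (cardF : #|F| = p) (p_gt3 : (3 < p)%N) (Dp : p = h.*2.+1).
Hypothesis p_mod3 : (0 < p %% 3)%N.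

Let n2 : 2%:R != 0 :> F. Proof. by apply: (pchar_natr_neq0 charF); lia. Qed.
Let n3 : 3%:R != 0 :> F. Proof. by apply: (pchar_natr_neq0 charF); lia. Qed.
Let n4 : 4%:R != 0 :> F. Proof. by rewrite (natrM F 2 2) mulf_neq0. Qed.
Let n12 : 12%:R != 0 :> F. Proof. by rewrite (natrM F 3 4) mulf_neq0. Qed.
Let n27 : 27%:R != 0 :> F. Proof. by rewrite (natrM F 3 9) (natrM F 3 3) !mulf_neq0. Qed.

Lemma natr_residue12 (k i : nat) : p = (12 * k + i)%N -> k%:R = - (i%:R / 12%:R) :> F.
Proof.
move=> E; apply: (mulfI n12); have : (12 * k + i)%:R = 0 :> F by rewrite -E (pcharf0 charF).
rewrite [LHS]natrD natrM mulrN => /eqP; rewrite addr_eq0 => /eqP ->.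
by rewrite mulrCA mulfV // mulr1.
Qed.

Definition sum_disc_m (m n : F) : F :=
  \sum_(0 <= k < (p %/ 12).+1) 'C(p %/ 12, k)%:R * 'C((5 * p) %/ 12, k)%:R *
    ((4%:R * m ^+ 3 + 27%:R * n ^+ 2) / (4%:R * m ^+ 3)) ^+ k.

Definition sum_disc_n (m n : F) : F :=
  \sum_(0 <= k < (p %/ 12).+1) 'C(p %/ 6, 2 * k)%:R * 'C((p - 1) %/ 2, k)%:R *
    (- ((4%:R * m ^+ 3 + 27%:R * n ^+ 2) / (27%:R * n ^+ 2))) ^+ k.

Lemma cubic_coef_disc_m (A : nat) (m n : F) : m != 0 -> (h <= A.*2 <= h.+1)%N ->
  cubic_coef h m n * ((- 3%:R) ^+ (h.*2 - 3 * A) * 2%:R ^+ (A.*2 - h)) =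
  3%:R ^+ h * (m ^+ (h.*2 - 3 * A) * n ^+ (A.*2 - h)) * sum_disc_m m n.
Proof.
move=> m0 A_bnd; rewrite /sum_disc_m.
pose r := (p %/ 12)%N; pose s := (5 * p %/ 12)%N; rewrite -/r -/s.
have [[le_rs lt_rs Ar_bnd] res] := residue12_up p_gt3 Dp p_mod3 A_bnd.
rewrite -/r -/s in le_rs lt_rs Ar_bnd res.
have recs J : 16%:R * ((J + 1) * (r%:R + s%:R - J)) =
     - ((4%:R * (A%:R + J) + 3%:R) * (4%:R * (A%:R + J) + 5%:R)) /\
  9%:R * ((s%:R - J) * (r%:R - J)) =
     (3%:R * (A%:R + J) + 1) * (3%:R * (A%:R + J) + 2%:R) :> F.
  (* Substituting r = -i/12 leaves polynomial identities in [J] with rational constants. *)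
  by case: res => -[/natr_residue12 Er -> ->];
    rewrite (natrD F (5 * r)) (natrD F (3 * r)) (natrM F 5) (natrM F 3) Er; split; field.
rewrite (cubic_coef_up charF cardF p_gt3 Dp n le_rs lt_rs A_bnd Ar_bnd _ _ m0) => [|J|J].
- by congr (_ * _); apply: eq_bigr => k _; congr (_ * _ ^+ _); field; rewrite m0 n4.
- by have [] := recs J.
by have [] := recs J.
Qed.

Lemma cubic_coef_disc_n (A : nat) (m n : F) :
  n != 0 -> (h.*2 < 3 * A.+1)%N -> (3 * A <= h.*2)%N ->
  cubic_coef h m n * ((- 3%:R) ^+ (h.*2 - 3 * A) * 2%:R ^+ (A.*2 - h)) =
  3%:R ^+ h * (m ^+ (h.*2 - 3 * A) * n ^+ (A.*2 - h)) * sum_disc_n m n.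
Proof.
move=> n0 A_gt A_le; rewrite /sum_disc_n.
have [[le_rs lt_rs u_bnd Ar_bnd] res] := residue12_down p_gt3 Dp p_mod3 A_gt A_le.
pose r := (p %/ 12)%N; pose s := (7 * p %/ 12)%N; pose u := (p %/ 6)%N.
rewrite -/r -/s -/u in le_rs lt_rs u_bnd Ar_bnd res *.
have recs J : [/\ 9%:R * ((J + 1) * (r%:R + s%:R - J)) =
     - ((3%:R * (A%:R - J) - 2%:R) * (3%:R * (A%:R - J) - 1)),
  16%:R * ((s%:R - J) * (r%:R - J)) =
     (4%:R * (A%:R - J) - 1) * (4%:R * (A%:R - J) + 1) &
  (u%:R - 2%:R * J) * (u%:R - 2%:R * J - 1) = 4%:R * ((r%:R - J) * (s%:R - J)) :> F].
  by case: res => -[/natr_residue12 Er -> -> ->];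
    rewrite (natrD F (7 * r)) (natrD F (4 * r)) (natrD F (2 * r)) (natrM F 7) (natrM F 4)
      (natrM F 2) Er; split; field.
rewrite (cubic_coef_down charF cardF p_gt3 Dp m le_rs lt_rs A_gt A_le Ar_bnd _ _ n0) => [|J|J].
- congr (_ * _); apply: eq_big_nat => k /andP[_]; rewrite ltnS => le_kr.
  have -> : ((p - 1) %/ 2 = h)%N by rewrite Dp subn1 -muln2 mulnK.
  have := bin_double_mul charF cardF p_gt3 Dp le_kr le_rs u_bnd; rewrite -/u => <-; last first.
    by move=> J; have [] := recs J.
  (* The sign (-1)^k from [bin_double_mul] joins the base, which becomes minus 1 + rho t. *)
  rewrite -[X in _ = _ * X ^+ k]mulN1r exprMn [RHS]mulrA; congr (_ * _ ^+ _); field.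
  by rewrite n0 n27.
- by have [] := recs J.
by have [] := recs J.
Qed.

Lemma expr_double_opp (x : F) (q : nat) : x ^+ (2 * q) = (- x) ^+ q * (- x) ^+ q.
Proof. by rewrite -exprD addnn -mul2n !(exprM _ 2) sqrrN. Qed.

(** With [A] = q the monomial is m^q, and 3^h = ((-3)^q)^2 absorbs the divisor (-3)^q. *)
Lemma sum_cubic_1mod4 (q : nat) (m n : F) : m != 0 -> p = (4 * q).+1 ->
  \sum_(x : F) (x ^+ 3 + m * x + n) ^+ h = - (- 3%:R * m) ^+ q * sum_disc_m m n.
Proof.
move=> m0 Ep; rewrite (sum_cubic_exp charF cardF p_gt3 Dp) mulNr; congr (- _).
have Eh : h = (2 * q)%N by lia.
have := @cubic_coef_disc_m q m n m0.
have [-> ->] : (h.*2 - 3 * q = q /\ q.*2 - h = 0)%N by lia.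
rewrite !expr0 !mulr1 => /(_ ltac:(lia)) E.
apply: (mulIf (expf_neq0 q (_ : - 3%:R != 0))); first by rewrite oppr_eq0.
by rewrite E Eh expr_double_opp exprMn; ring.
Qed.

(** Here h = 2q + 3 and [A] = q + 2, so the monomial is m^q n. The prefactor with m^2 below
    completes (-3m)^q to the exponent q + 2 = (p + 1)/4. *)
Lemma sum_cubic_3mod4 (q : nat) (m n : F) : m != 0 -> p = (4 * q.+1).+3 ->
  \sum_(x : F) (x ^+ 3 + m * x + n) ^+ h =
    - (3%:R * n / (2%:R * m ^+ 2)) * (- 3%:R * m) ^+ q.+2 * sum_disc_m m n.
Proof.
move=> m0 Ep; rewrite (sum_cubic_exp charF cardF p_gt3 Dp) -[RHS]mulrA [RHS]mulNr; congr (- _).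
have Eh : h = (2 * q).+3%N by lia.
have := @cubic_coef_disc_m q.+2 m n m0.
have [-> ->] : (h.*2 - 3 * q.+2 = q /\ q.+2.*2 - h = 1)%N by lia.
rewrite !expr1 => /(_ ltac:(lia)) E.
have m3q : (- 3%:R) ^+ q != 0 :> F by rewrite expf_neq0 // oppr_eq0.
apply: (mulIf (mulf_neq0 m3q n2)).
rewrite E Eh !exprS expr_double_opp exprMn; field.
by rewrite m0 n2.
Qed.

(** With [A] = 2u the monomial is n^u; -3 is a square, so 3^h = (-1)^h. *)
Lemma sum_cubic_1mod3 (u : nat) (m n : F) : n != 0 -> p = (6 * u).+1 ->
  \sum_(x : F) (x ^+ 3 + m * x + n) ^+ h = (- 1) ^+ h.+1 * (n / 2%:R) ^+ u * sum_disc_n m n.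
Proof.
move=> n0 Ep; rewrite (sum_cubic_exp charF cardF p_gt3 Dp) exprS !mulN1r !mulNr; congr (- _).
have Eh : h = (3 * u)%N by lia.
have := @cubic_coef_disc_n (2 * u) m n n0.
have [-> ->] : (h.*2 - 3 * (2 * u) = 0 /\ (2 * u).*2 - h = u)%N by lia.
rewrite !expr0 !mul1r => /(_ ltac:(lia) ltac:(lia)) E.
have E3 : (-1) ^+ h * 3%:R ^+ h = 1 :> F.
  rewrite -exprMn mulN1r (@finField_minus3_split _ _ _ u.*2) // cardF //.
  by rewrite Ep; lia.
have sh0 : (-1) ^+ h != 0 :> F by rewrite signr_eq0.
have s1 : (-1) ^+ h * (-1) ^+ h = 1 :> F by rewrite -expr2 sqrr_sign.
have -> : (-1) ^+ h = 3%:R ^+ h :> F by apply: (mulfI sh0); rewrite s1 E3.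
have u0 : 2%:R ^+ u != 0 :> F by rewrite expf_neq0.
by apply: (mulIf u0); rewrite E expr_div_n; field.
Qed.

(** With [A] = 2u + 1 the monomial is m n^u; -3 is a nonsquare, so 3^h = -(-1)^h, and this sign
    cancels that of the divisor -3. *)
Lemma sum_cubic_2mod3 (u : nat) (m n : F) : n != 0 -> p = (6 * u + 5)%N ->
  \sum_(x : F) (x ^+ 3 + m * x + n) ^+ h =
    (- 1) ^+ h.+1 * (m / 3%:R) * (n / 2%:R) ^+ u * sum_disc_n m n.
Proof.
move=> n0 Ep; rewrite (sum_cubic_exp charF cardF p_gt3 Dp) exprS !mulN1r !mulNr; congr (- _).
have := @cubic_coef_disc_n (2 * u).+1 m n n0.
have [-> ->] : (h.*2 - 3 * (2 * u).+1 = 1 /\ (2 * u).+1.*2 - h = u)%N by lia.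
rewrite !expr1 => /(_ ltac:(lia) ltac:(lia)) E.
have E3 : (-1) ^+ h * 3%:R ^+ h = -1 :> F.
  rewrite -exprMn mulN1r (@finField_minus3_inert _ _ _ u.*2.+1) // cardF //.
  by rewrite Ep; lia.
have sh0 : (-1) ^+ h != 0 :> F by rewrite signr_eq0.
have s1 : (-1) ^+ h * (-1) ^+ h = 1 :> F by rewrite -expr2 sqrr_sign.
have -> : (-1) ^+ h = - 3%:R ^+ h :> F
  by apply: (mulfI sh0); rewrite s1 mulrN E3 opprK.
have u0 : 2%:R ^+ u != 0 :> F by rewrite expf_neq0.
have m3 : - 3%:R != 0 :> F by rewrite oppr_eq0.
by apply: (mulIf (mulf_neq0 m3 u0)); rewrite E expr_div_n; field; rewrite ?n3 ?u0.
Qed.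
End CubicSum.

(** * Residues of p-integral rationals *)

Section Residue.
Variable p : nat.
Hypothesis p_prime : prime p.
Implicit Types (x y : rat) (s t : 'F_p).

Lemma intr_Fp_eq0 (a : int) : ((a%:~R : 'F_p) == 0) = (p %| `|a|)%N.
Proof. by rewrite -(dvdz_pcharf (pchar_Fp p_prime)) dvdzE. Qed.

Lemma ZlocE x : (x \in Zloc p) = ((denq x)%:~R != 0 :> 'F_p).
Proof. by rewrite intr_Fp_eq0 inE prime_coprime. Qed.

(** Integrality and residue are carried together, so one pass over an expression proves both. *)
Definition Zres x s := x \in Zloc p /\ residue p x = s.

Lemma Zres_residue x : x \in Zloc p -> Zres x (residue p x).
Proof. by []. Qed.

(** [residue] reads lowest terms; cross-multiplication extends it to any fraction with denominator
    prime to p. *)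
Lemma Zres_frac (a b : int) : b%:~R != 0 :> 'F_p -> Zres (a%:~R / b%:~R) (a%:~R / b%:~R).
Proof.
move=> b0; set x : rat := a%:~R / b%:~R.
have b0Q : b%:~R != 0 :> rat by rewrite intr_eq0; apply: contraNneq b0 => ->.
have cross : numq x * b = a * denq x.
  apply: (@intr_inj rat); rewrite !rmorphM /=.
  have dx0 : (denq x)%:~R != 0 :> rat by rewrite intr_eq0 denq_neq0.
  by apply: (mulIf (invr_neq0 dx0)); rewrite mulfK // mulrAC divq_num_den /x mulfVK.
have crossF : (numq x)%:~R * b%:~R = a%:~R * (denq x)%:~R :> 'F_p by rewrite -!rmorphM /= cross.
have dx0 : (denq x)%:~R != 0 :> 'F_p.
  (* If p divided the reduced denominator, it would divide the numerator as well. *)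
  apply/negP=> d0; move: crossF; rewrite (eqP d0) mulr0 => /eqP.
  rewrite mulf_eq0 (negPf b0) orbF !intr_Fp_eq0 in d0 * => n0.
  have := coprime_num_den x; rewrite /coprime => /eqP g1.
  by have := prime_gt1 p_prime; rewrite ltnNge dvdn_leq // -g1 dvdn_gcd n0 d0.
split; first by rewrite ZlocE.
by apply: (mulIf b0); rewrite mulfVK // /residue /ratr mulrAC crossF mulfK.
Qed.

Lemma Zres_ratP x s : Zres x s ->
  exists a b : int, [/\ b%:~R != 0 :> 'F_p, x = a%:~R / b%:~R & s = a%:~R / b%:~R].
Proof.
move=> [xZ <-]; exists (numq x), (denq x); split; first by rewrite -ZlocE.
  by rewrite divq_num_den.
by [].
Qed.

Let nzQ (b : int) : b%:~R != 0 :> 'F_p -> b%:~R != 0 :> rat.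
Proof. by rewrite intr_eq0; apply: contraNneq => ->. Qed.

Lemma Zres_int (a : int) : Zres a%:~R a%:~R.
Proof. by have := @Zres_frac a 1; rewrite !divr1; apply; exact: oner_neq0. Qed.

Lemma Zres_nat (a : nat) : Zres a%:R a%:R.
Proof. exact: Zres_int a. Qed.

Lemma ZresD x y s t : Zres x s -> Zres y t -> Zres (x + y) (s + t).
Proof.
move=> /Zres_ratP[a [b [b0 -> ->]]] /Zres_ratP[c [d [d0 -> ->]]].
rewrite !addf_div ?nzQ // -!rmorphM -!rmorphD /=.
by apply: Zres_frac; rewrite rmorphM mulf_neq0.
Qed.

Lemma ZresM x y s t : Zres x s -> Zres y t -> Zres (x * y) (s * t).
Proof.
move=> /Zres_ratP[a [b [b0 -> ->]]] /Zres_ratP[c [d [d0 -> ->]]].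
rewrite !mulf_div -!rmorphM /=.
by apply: Zres_frac; rewrite rmorphM mulf_neq0.
Qed.

Lemma ZresN x s : Zres x s -> Zres (- x) (- s).
Proof. by move=> xs; rewrite -mulN1r -[- s]mulN1r; apply: ZresM xs; exact: (Zres_int (-1)). Qed.

Lemma ZresV x s : s != 0 -> Zres x s -> Zres x^-1 s^-1.
Proof.
move=> s0 /Zres_ratP[a [b [b0 -> Es]]]; rewrite Es in s0 *.
by rewrite !invf_div; apply: Zres_frac; move: s0; rewrite mulf_eq0 negb_or => /andP[].
Qed.

Lemma ZresX k x s : Zres x s -> Zres (x ^+ k) (s ^+ k).
Proof.
move=> xs; elim: k => [|k IHk]; first exact: Zres_nat 1.
by rewrite !exprS; apply: ZresM.
Qed.

Lemma Zres_sum (n1 n2 : nat) (f : nat -> rat) (g : nat -> 'F_p) :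
  (forall i, Zres (f i) (g i)) ->
  Zres (\sum_(n1 <= i < n2) f i) (\sum_(n1 <= i < n2) g i).
Proof.
by move=> fg; elim/big_ind2: _ => //; [exact: Zres_nat 0 | move=> *; exact: ZresD].
Qed.

(** The difference is a/b with p dividing [a] and not [b], so its quotient by p is still
    p-integral. *)
Lemma Zres_Zcongr x y s : Zres x s -> Zres y s -> Zcongr p x y.
Proof.
move=> xs ys; rewrite /Zcongr (proj1 xs) (proj1 ys) /=.
have [a [b [b0 Exy /esym/eqP]]] := Zres_ratP (ZresD xs (ZresN ys)).
rewrite subrr mulf_eq0 invr_eq0 (negPf b0) orbF intr_Fp_eq0 => /dvdnP[k Ea].
have p0 : p%:R != 0 :> rat by rewrite pnatr_eq0 -lt0n prime_gt0.
have [c Ec] : exists c : int, a = c * p%:Z.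
  by exists (sgz a * k%:Z); rewrite -mulrA -PoszM -Ea -intEsg.
rewrite Exy Ec rmorphM /= mulrAC mulfK //.
by case: (Zres_frac c b0).
Qed.

Lemma sum_Fp (G : 'F_p -> 'F_p) : \sum_(0 <= x < p) G x%:R = \sum_(x : 'F_p) G x.
Proof.
rewrite big_mkord (reindex (fun i : 'I_p => (i : nat)%:R : 'F_p)) //=.
apply/onW_bij/inj_card_bij; last by rewrite card_Fp // card_ord.
move=> i j /(congr1 (@nat_of_ord _)); rewrite !val_Fp_nat // !modn_small //.
exact: val_inj.
Qed.

Lemma Zres_legendre (h : nat) x s : p = h.*2.+1 -> Zres x s ->
  Zres (legendre p x)%:~R (s ^+ h).
Proof.
move=> Dp [_ Es]; suff <- : (legendre p x)%:~R = s ^+ h :> 'F_p by exact: Zres_int.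
have h0 : (0 < h)%N by rewrite -double_gt0 -ltnS -Dp prime_gt1.
rewrite /legendre Es; case: eqVneq => [->|s0]; first by rewrite expr0n gtn_eqF.
by rewrite (finField_euler _ s0) ?card_Fp //; case: ifP.
Qed.
End Residue.

(** * Transfer of the evaluations to congruences in Z_p *)

Theorem theorem3p3 (p : nat) (m n : rat)
  (p_prime : prime p) (p_gt3 : (3 < p)%N)
  (m_Zp : m \in Zloc p) (n_Zp : n \in Zloc p)
  (mn_neq0 : ~~ Zcongr p (m * n) 0) :
  let S : rat :=
    (\sum_(0 <= x < p) legendre p (x%:R ^+ 3 + m * x%:R + n))%:~R in
  let A : rat :=
    \sum_(0 <= k < (p %/ 12).+1)
      ('C(p %/ 12, k))%:R * ('C((5 * p) %/ 12, k))%:R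
      * ((4 * m ^+ 3 + 27 * n ^+ 2) / (4 * m ^+ 3)) ^+ k in
  let B : rat :=
    \sum_(0 <= k < (p %/ 12).+1)
      ('C(p %/ 6, 2 * k))%:R * ('C((p - 1) %/ 2, k))%:R
      * (- ((4 * m ^+ 3 + 27 * n ^+ 2) / (27 * n ^+ 2))) ^+ k in
  (((4 %| p - 1)%N ->
      Zcongr p S (- (- 3 * m) ^+ ((p - 1) %/ 4) * A)) /\
   ((4 %| p - 3)%N ->
      Zcongr p S
        (- (3 * n / (2 * m ^+ 2)) * (- 3 * m) ^+ ((p + 1) %/ 4) * A))) /\
  (((3 %| p - 1)%N ->
      Zcongr p S
        ((-1) ^+ ((p + 1) %/ 2) * (n / 2) ^+ ((p - 1) %/ 6) * B)) /\
   ((3 %| p - 2)%N ->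
      Zcongr p S
        ((-1) ^+ ((p + 1) %/ 2) * (m / 3) * (n / 2) ^+ ((p - 5) %/ 6) * B))).
Proof.
move=> S A B.
have charF := pchar_Fp p_prime; have cardF := card_Fp p_prime.
have p_mod3 : (0 < p %% 3)%N.
  by rewrite lt0n; apply/negP => /eqP/eqP; rewrite -/(dvdn 3 p) dvdn_prime2 // ltn_eqF.
have [h Dp] : exists h, p = h.*2.+1.
  have := prime_oddPn p_prime; have [odd_p _|_ /(_ isT) p2] := boolP (odd p).
    by exists p./2; rewrite -[LHS]odd_double_half odd_p.
  by rewrite p2 in p_gt3.
have nzF i : (0 < i < p)%N -> i%:R != 0 :> 'F_p by exact: (pchar_natr_neq0 charF).
have n2 : 2%:R != 0 :> 'F_p by apply: nzF; lia.
have n3 : 3%:R != 0 :> 'F_p by apply: nzF; lia.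
have n4 : 4%:R != 0 :> 'F_p by rewrite (natrM _ 2 2) mulf_neq0.
have n27 : 27%:R != 0 :> 'F_p by rewrite (natrM _ 3 9) (natrM _ 3 3) !mulf_neq0.
have mZ := Zres_residue m_Zp; have nZ := Zres_residue n_Zp.
set M := residue p m in mZ; set N := residue p n in nZ.
have /andP[M0 N0] : (M != 0) && (N != 0).
  rewrite -negb_or -mulf_eq0; apply: contra mn_neq0 => /eqP MN0.
  apply: (Zres_Zcongr p_prime _ (Zres_nat p_prime 0)).
  by have := ZresM p_prime mZ nZ; rewrite MN0.
have natZ i : Zres i%:R (i%:R : 'F_p) := Zres_nat p_prime i.
have discZ : Zres (4 * m ^+ 3 + 27 * n ^+ 2) (4%:R * M ^+ 3 + 27%:R * N ^+ 2).
  by apply: ZresD => //; apply: ZresM => //; apply: ZresX.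
have SZ : Zres S (\sum_(x : 'F_p) (x ^+ 3 + M * x + N) ^+ h).
  rewrite /S rmorph_sum -sum_Fp //=; apply: Zres_sum => // x.
  apply: Zres_legendre => //; apply: ZresD => //; apply: ZresD => //; last exact: ZresM.
  exact: ZresX.
have AZ : Zres A (sum_disc_m p M N).
  apply: Zres_sum => // k; apply: ZresM => //; first exact: ZresM.
  apply: ZresX => //; apply: ZresM => //; apply: ZresV => //; first by rewrite mulf_neq0 ?expf_neq0.
  by apply: ZresM => //; apply: ZresX.
have BZ : Zres B (sum_disc_n p M N).
  apply: Zres_sum => // k; apply: ZresM => //; first exact: ZresM.
  apply: ZresX => //; apply: ZresN => //; apply: ZresM => //; apply: ZresV => //.
    by rewrite mulf_neq0 ?expf_neq0.
  by apply: ZresM => //; apply: ZresX.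
have m3Z k : Zres ((- 3 * m) ^+ k) ((- 3%:R * M) ^+ k).
  by apply: ZresX => //; apply: ZresM => //; apply: ZresN.
have n2Z k : Zres ((n / 2) ^+ k) ((N / 2%:R) ^+ k).
  by apply: ZresX => //; apply: ZresM => //; apply: ZresV.
have sgnZ : Zres ((-1) ^+ ((p + 1) %/ 2)) ((-1) ^+ h.+1 : 'F_p).
  have -> : ((p + 1) %/ 2 = h.+1)%N by clear -Dp; lia.
  by apply: ZresX => //; apply: ZresN => //; exact: natZ 1%N.
split; split=> dvd_p; apply: (Zres_Zcongr p_prime SZ).
- have [q [Ep ->]] : (exists q, p = (4 * q).+1 /\ (p - 1) %/ 4 = q)%N.
    by case/dvdnP: dvd_p => q Eq; exists q; clear -p_gt3 Eq; split; lia.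
  rewrite (sum_cubic_1mod4 charF cardF p_gt3 Dp p_mod3 (q := q)) //.
  by apply: ZresM => //; apply: ZresN.
- have [q [Ep ->]] : (exists q, p = (4 * q.+1).+3 /\ (p + 1) %/ 4 = q.+2)%N.
    (* From p > 3 the quotient (p - 3)/4 is positive, so it has a predecessor. *)
    by case/dvdnP: dvd_p => q Eq; exists q.-1; clear -p_gt3 Eq; split; lia.
  rewrite (sum_cubic_3mod4 charF cardF p_gt3 Dp p_mod3 (q := q)) //.
  apply: ZresM => //; apply: ZresM => //; apply: ZresN => //.
  apply: ZresM => //; first exact: ZresM.
  apply: ZresV => //; first by rewrite mulf_neq0 ?expf_neq0.
  by apply: ZresM => //; apply: ZresX.
- have [u [Ep ->]] : (exists u, p = (6 * u).+1 /\ (p - 1) %/ 6 = u)%N.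
    (* Since p is odd, (p - 1)/3 is even. *)
    by case/dvdnP: dvd_p => u Eu; exists u./2; clear -p_gt3 Eu Dp; split; lia.
  rewrite (sum_cubic_1mod3 charF cardF p_gt3 Dp p_mod3 (u := u)) //.
  by apply: ZresM => //; apply: ZresM.
have [u [Ep ->]] : (exists u, p = 6 * u + 5 /\ (p - 5) %/ 6 = u)%N.
  (* Since p is odd, (p - 2)/3 is odd, and halving drops the 1. *)
  by case/dvdnP: dvd_p => u Eu; exists u./2; clear -p_gt3 Eu Dp; split; lia.
rewrite (sum_cubic_2mod3 charF cardF p_gt3 Dp p_mod3 (u := u)) //.
apply: ZresM => //; apply: ZresM => //; apply: ZresM => //; apply: ZresM => //; exact: ZresV.
Qed.
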